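(* Let $\Gamma$ be a finite, simple, connected, regular graph with diameter $D$ and distinct adjacency eigenvalues $\lambda_0>\lambda_1>\cdots>\lambda_d$. Let $0\le h\le D$ and suppose that $\langle p_i(A),A_h\rangle=0$ for $i=h+1,\dots,d$. Then $\overline{\delta}_h\le p_h(\lambda_0)$, with equality if and only if $\Gamma$ is $h$-punctually distance-regular.
   Context: $A$ is the adjacency matrix of $\Gamma$, $n$ the number of vertices, $m_i$ the multiplicity of $\lambda_i$, $\partial(u,v)$ the distance. The distance-$i$ matrix $A_i$ ($0\le i\le D$) has $(A_i)_{uv}=1$ if $\partial(u,v)=i$ and $0$ otherwise; $\overline{\delta}_h=\frac1n\sum_{u,v}(A_h)_{uv}$ is the average degree of the distance-$h$ graph. For symmetric matrices $R,S$, $\langle R,S\rangle=\frac1n\operatorname{tr}(RS)$. On the space $\mathbb{R}_d[x]$ of real polynomials of degree at most $d$, $\langle p,q\rangle=\frac1n\operatorname{tr}(p(A)q(A))=\frac1n\sum_{i=0}^d m_ip(\lambda_i)q(\lambda_i)$. The predistance polynomials $p_0,\dots,p_d$ are the unique polynomials with $\deg p_i=i$, $\langle p_i,p_j\rangle=0$ for $i\ne j$, and $\langle p_i,p_i\rangle=p_i(\lambda_0)$. $\Gamma$ is $h$-punctually distance-regular if $A_h=q_h(A)$ for some polynomial $q_h\in\mathbb{R}_d[x]$ with $\deg q_h=h$. *)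

(* Defs.v *)
From HB Require Import structures.
From mathcomp Require Import all_boot all_order all_algebra.
From mathcomp Require Import reals.

Set Implicit Arguments.
Unset Strict Implicit.
Unset Printing Implicit Defensive.

Import Order.TTheory GRing.Theory Num.Theory.
Local Open Scope ring_scope.

Section Graph.
Variables (T : finType) (e : rel T).

Definition simple_graph := symmetric e /\ irreflexive e.

Definition connected_graph := forall u v : T, connect e u v.

Definition regular_graph := exists k : nat, forall u : T, #|[pred v | e u v]| = k.

Definition walk (k : nat) (u v : T) : bool :=
  [exists p : k.-tuple T, path e u p && (last u p == v)].

(* Least length of a walk from u to v. A shortest walk repeats no vertex, so
   its length is less than #|T|; the value is #|T| when no walk exists. *)
Definition dist (u v : T) : nat := find (fun k => walk k u v) (iota 0 #|T|).

Definition diameter : nat := (\max_(u : T) \max_(v : T) dist u v)%N.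

End Graph.

Section Spectral.
Variables (R : realType) (n : nat).

Section Matrices.
Variable e : rel 'I_n.+1.

Definition adjmx : 'M[R]_n.+1 := \matrix_(u, v) (e u v)%:R.

Definition distmx (h : nat) : 'M[R]_n.+1 := \matrix_(u, v) (dist e u v == h)%:R.

Definition avg_degree (h : nat) : R :=
  n.+1%:R^-1 * \sum_(u < n.+1) \sum_(v < n.+1) distmx h u v.

End Matrices.

Definition mxdot (M N : 'M[R]_n.+1) : R := n.+1%:R^-1 * \tr (M *m N).

Definition polydot (A : 'M[R]_n.+1) (p q : {poly R}) : R :=
  mxdot (horner_mx A p) (horner_mx A q).

Definition distinct_eigenvalues (A : 'M[R]_n.+1) (d : nat)
    (lam : 'I_d.+1 -> R) : Prop :=
  (forall i j : 'I_d.+1, (i < j)%N -> lam j < lam i) /\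
  (forall a : R, eigenvalue A a <-> exists i : 'I_d.+1, lam i = a).

(* Only p 0, ..., p d are constrained; size p = deg p + 1. *)
Definition predistance_polys (A : 'M[R]_n.+1) (d : nat)
    (lam : 'I_d.+1 -> R) (p : nat -> {poly R}) : Prop :=
  [/\ forall i, (i <= d)%N -> size (p i) = i.+1,
      forall i j, (i <= d)%N -> (j <= d)%N -> i != j ->
        polydot A (p i) (p j) = 0
    & forall i, (i <= d)%N -> polydot A (p i) (p i) = (p i).[lam ord0]].

Definition punctually_distance_regular (e : rel 'I_n.+1) (d h : nat) : Prop :=
  exists q : {poly R},
    [/\ (size q <= d.+1)%N, size q = h.+1
      & distmx e h = horner_mx (adjmx e) q].

End Spectral.

Arguments adjmx R {n} e.
Arguments distmx R {n} e h.
Arguments avg_degree R {n} e h.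
Arguments punctually_distance_regular R {n} e d h.

(* Main.v *)
(** Write [A_h] for the distance-[h] matrix. Entries of [p_i(A)] at distance
    [h > i] vanish, so together with the hypothesis [A_h] is orthogonal to every
    [p_i(A)] with [i != h]. Hoffman's theorem expresses the all-ones matrix as
    [\sum_i p_i(A)], so the average degree, which is both [<J, A_h>] and
    [<A_h, A_h>], equals [<p_h(A), A_h>]. Hence
    [|A_h - p_h(A)|^2 = p_h(lambda_0) - avg_degree h], which gives the bound and
    one direction of the equality case. Conversely, if [A_h = q(A)] with
    [deg q = h], expanding [q] in the [p_i] shows that the coefficient of [p_h]
    is 1 and that [<A_h, p_h(A)>] is also [p_h(lambda_0)]. *)
Require Import Defs.
From HB Require Import structures.
From mathcomp Require Import all_boot all_order all_algebra.
From mathcomp Require Import reals complex spectral ring.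

Set Implicit Arguments.
Unset Strict Implicit.
Unset Printing Implicit Defensive.

Import Order.TTheory GRing.Theory Num.Theory.
Local Open Scope ring_scope.

(** Both sides are monic with the same roots in [R], so the point is that the minimal polynomial has
    only simple real roots: over [complex R] the matrix is Hermitian, hence diagonalizable with real
    spectrum. *)
Lemma symmetric_mxminpoly (R : rcfType) (n : nat) (A : 'M[R]_n.+1)
  (rs : seq R) : A^T = A -> uniq rs -> eigenvalue A =i rs ->
  mxminpoly A = \prod_(r <- rs) ('X - r%:P).
Proof.
move=> symA uniq_rs rsE.
have rootE r : root (mxminpoly A) r = (r \in rs).
  by rewrite root_mxminpoly -eigenvalue_root_char -rsE.
apply/eqP; rewrite -eqp_monic ?mxminpoly_monic ?monic_prod_XsubC //.
apply/andP; split; last first.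
  apply: uniq_roots_dvdp; rewrite ?uniq_rootsE //.
  by apply/allP => r; rewrite rootE.
(* Divisibility and minimal polynomials are compatible with this embedding, so the spectral theorem
   can be applied to the image [B] of [A]. *)
pose f : {rmorphism R -> complex R} := real_complex R.
rewrite -(dvdp_map f) -mxminpoly_map.
set B := map_mx _ _.
have hermB : B \is hermsymmx.
  apply: realsym_hermsym.
    by apply/is_hermitianmxP; rewrite expr0 scale1r map_mx_id // {2}/B map_trmx symA.
  by apply/mxOverP => i j; rewrite !mxE complex_real.
have := hermitian_spectral_diag_real hermB.
have /orthomx_spectralP := hermitian_normalmx hermB.
set P := spectralmx B; set D := spectral_diag B => BE realD.
have unitP : P \in unitmx by apply: spectral_unit.
have minBE : mxminpoly B = mxminpoly (diag_mx D).
  apply: (simmx_minpoly unitP); apply/simmxP => //.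
  by rewrite {1}BE !mulmxA mulmxV // mul1mx.
have minDE := mxminpoly_diag D; rewrite minBE minDE.
apply: uniq_roots_dvdp; last by rewrite uniq_rootsE undup_uniq.
apply/allP => x xD.
have : root (mxminpoly (diag_mx D)) x by rewrite minDE root_prod_XsubC.
move: xD; rewrite mem_undup => /mapP[i _ ->].
(* A diagonal entry is real, so it is the image of a root [r] of [mxminpoly A]. *)
have /complex_realP[r ->] := mxOverP realD ord0 i.
rewrite -minBE mxminpoly_map (fmorph_root f) rootE => r_rs.
by rewrite (fmorph_root f) root_prod_XsubC.
Qed.

(** * Walks, distances and powers of the adjacency matrix *)

Lemma walkP (T : finType) (e : rel T) (k : nat) (u v : T) :
  reflect (exists p, [/\ size p = k, path e u p & last u p = v]) (walk e k u v).
Proof.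
apply: (iffP existsP) => [[p /andP[ep /eqP lp]]|[p [sp ep lp]]].
  by exists p; rewrite size_tuple.
by move/eqP: sp => sp; exists (Tuple sp); rewrite /= ep lp eqxx.
Qed.

Lemma walk_dist_le (T : finType) (e : rel T) (k : nat) (u v : T) :
  walk e k u v -> (dist e u v <= k)%N.
Proof.
rewrite leqNgt; apply: contraL => lt_k; move: (lt_k).
(* [dist] is at most its default [#|T|], so [k] lies in the searched range. *)
have k_lt : (k < #|T|)%N.
  by apply: leq_trans lt_k _; rewrite -[leqRHS](size_iota 0) find_size.
by move/(before_find 0); rewrite nth_iota // => ->.
Qed.

(** A path without repeated vertices is shorter than [#|T|], so the search in [dist] succeeds and
    its default value is not reached. *)
Lemma walk_dist (T : finType) (e : rel T) (u v : T) :
  connected_graph e -> walk e (dist e u v) u v.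
Proof.
move=> /(_ u v)/connectP[p0 ep0 ->]; case: (shortenP ep0) => p ep up _.
set v' := last u p.
have hasw : has (fun k => walk e k u v') (iota 0 #|T|).
  apply/hasP; exists (size p); last by apply/walkP; exists p.
  by rewrite mem_iota -[(_ < _)%N]/(size (u :: p) <= _)%N -(card_uniqP up) max_card.
have := nth_find 0 hasw; rewrite nth_iota //.
by move: hasw; rewrite has_find size_iota.
Qed.

Lemma diameter_attained (T : finType) (e : rel T) (u0 : T) :
  exists u v, dist e u v = diameter e.
Proof.
have T_gt0 : (0 < #|T|)%N by apply/card_gt0P; exists u0.
have [u uE] := bigop.eq_bigmax (fun u => (\max_v dist e u v)%N) T_gt0.
have [v vE] := bigop.eq_bigmax (dist e u) T_gt0.
by exists u, v; rewrite /diameter uE vE.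
Qed.

Lemma adjmx_tr (R : realType) (n : nat) (e : rel 'I_n.+1) :
  symmetric e -> (adjmx R e)^T = adjmx R e.
Proof. by move=> sym_e; apply/matrixP => u v; rewrite !mxE sym_e. Qed.

Lemma adjmx_exp_ge0 (R : realType) (n : nat) (e : rel 'I_n.+1) (k : nat)
  (u v : 'I_n.+1) : 0 <= (adjmx R e ^+ k) u v.
Proof.
elim: k u => [|k IHk] u; first by rewrite expr0 mxE ler0n.
rewrite exprS -mulmxE mxE sumr_ge0 // => w _.
by rewrite mulr_ge0 // mxE ler0n.
Qed.

(** All summands in an entry of a power are nonnegative, so no cancellation can hide a walk. *)
Lemma adjmx_exp_neq0 (R : realType) (n : nat) (e : rel 'I_n.+1) (k : nat)
  (u v : 'I_n.+1) : ((adjmx R e ^+ k) u v != 0) = walk e k u v.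
Proof.
elim: k u => [|k IHk] u.
  rewrite expr0 mxE pnatr_eq0 eqb0 negbK.
  apply/eqP/walkP => [->|[p [/size0nil -> //]]]; by exists [::].
rewrite exprS -mulmxE mxE psumr_neq0; last first.
  by move=> w _; rewrite mulr_ge0 ?adjmx_exp_ge0 // mxE ler0n.
apply/hasP/walkP => [[w _ /=]|[[[]//|w p [[sp] /andP[euw ep] lp]]]].
  rewrite lt0r mulf_eq0 negb_or IHk mxE pnatr_eq0 eqb0 negbK.
  move=> /andP[/andP[euw /walkP[p [sp ep lp]]] _].
  by exists (w :: p); rewrite /= sp euw.
exists w; first by rewrite mem_index_enum.
rewrite /= mxE euw mul1r lt0r adjmx_exp_ge0 IHk andbT.
by apply/walkP; exists p.
Qed.

Lemma horner_mxE (R : comNzRingType) (n : nat) (A : 'M[R]_n.+1) (p : {poly R}) :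
  horner_mx A p = \sum_(i < size p) p`_i *: A ^+ i.
Proof.
rewrite -[p in LHS]coefK poly_def rmorph_sum /=; apply: eq_bigr => i _.
by rewrite linearZ /= rmorphXn /= horner_mx_X.
Qed.

(** Only powers of [A] below the distance occur, and no walk that short joins [u] to [v]. *)
Lemma horner_adjmx_far (R : realType) (n : nat) (e : rel 'I_n.+1)
  (q : {poly R}) (u v : 'I_n.+1) :
  (size q <= dist e u v)%N -> horner_mx (adjmx R e) q u v = 0.
Proof.
move=> le_q; rewrite horner_mxE summxE big1 // => i _; rewrite mxE.
apply/eqP; rewrite mulf_eq0; apply/orP; right.
rewrite -[_ == 0]negbK adjmx_exp_neq0; apply/negP => /walk_dist_le.
by apply/negP; rewrite -ltnNge (leq_trans (ltn_ord i)).
Qed.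

(* If the diameter reached the degree of the minimal polynomial, [A ^+ D]
   would reduce to a polynomial in A of degree < D, which vanishes at a pair
   of vertices at distance D. *)
Lemma diameter_lt_mxminpoly (R : realType) (n : nat) (e : rel 'I_n.+1) :
  connected_graph e ->
  (diameter e < (size (mxminpoly (adjmx R e))).-1)%N.
Proof.
move=> conn_e; have [u [v uvD]] := diameter_attained e ord0.
rewrite size_mxminpoly /= ltnNge; apply/negP => le_dD.
have := walk_dist u v conn_e; rewrite uvD -(adjmx_exp_neq0 R) => /eqP; apply.
have -> : adjmx R e ^+ diameter e
    = horner_mx (adjmx R e) ('X^(diameter e) %% mxminpoly (adjmx R e)).
  rewrite -{1}[adjmx R e]horner_mx_X -rmorphXn /=.
  rewrite [in LHS](divp_eq 'X^_ (mxminpoly (adjmx R e))).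
  by rewrite rmorphD rmorphM /= mx_root_minpoly mulr0 add0r.
apply: horner_adjmx_far; rewrite uvD.
exact: leq_trans (size_mod_mxminpoly _ _) le_dD.
Qed.

Lemma horner_mx_tr (R : comNzRingType) (n : nat) (A : 'M[R]_n.+1) (p : {poly R}) :
  A^T = A -> (horner_mx A p)^T = horner_mx A p.
Proof.
move=> symA; rewrite horner_mxE raddf_sum /=; apply: eq_bigr => i _.
rewrite linearZ /=; congr (_ *: _).
elim: {i}(i : nat) => [|k IHk]; first by rewrite expr0 trmx1.
by rewrite exprSr -mulmxE trmx_mul IHk symA mulmxE -exprS exprSr.
Qed.

(** * The normalized trace form *)

Section Mxdot.
Variables (R : realType) (n : nat).
Implicit Types M N : 'M[R]_n.+1.

Lemma mxdotE M N : N^T = N ->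
  mxdot M N = n.+1%:R^-1 * \sum_u \sum_v M u v * N u v.
Proof.
move=> symN; congr (_ * _); apply: eq_bigr => u _.
by rewrite mxE; apply: eq_bigr => v _; rewrite -{1}symN mxE.
Qed.

Lemma mxdotC M N : mxdot M N = mxdot N M.
Proof. by rewrite /mxdot mxtrace_mulC. Qed.

Lemma mxdotDl M1 M2 N : mxdot (M1 + M2) N = mxdot M1 N + mxdot M2 N.
Proof. by rewrite /mxdot mulmxDl mxtraceD mulrDr. Qed.

Lemma mxdotZl a M N : mxdot (a *: M) N = a * mxdot M N.
Proof. by rewrite /mxdot -scalemxAl mxtraceZ mulrCA. Qed.

Lemma mxdot_suml (I : finType) (F : I -> 'M[R]_n.+1) N :
  mxdot (\sum_i F i) N = \sum_i mxdot (F i) N.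
Proof. by rewrite /mxdot mulmx_suml raddf_sum mulr_sumr. Qed.

Lemma mxdot_ge0 M : M^T = M -> 0 <= mxdot M M.
Proof.
move=> symM; rewrite mxdotE // mulr_ge0 ?invr_ge0 ?ler0n //.
by do 2![apply: sumr_ge0 => ? _]; rewrite -expr2 sqr_ge0.
Qed.

Lemma mxdot_eq0 M : M^T = M -> mxdot M M = 0 -> M = 0.
Proof.
move=> symM; rewrite mxdotE // => /eqP; rewrite mulf_eq0 invr_eq0 pnatr_eq0 /=.
have sq_ge0 u v : 0 <= M u v * M u v by rewrite -expr2 sqr_ge0.
rewrite psumr_eq0 => [/allP Mu0|u _]; last exact: sumr_ge0.
apply/matrixP => u v; move: (Mu0 u (mem_index_enum u)).
rewrite /= psumr_eq0 // => /allP/(_ v (mem_index_enum v)).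
by rewrite /= mulf_eq0 orbb mxE => /eqP.
Qed.

End Mxdot.

(** * The degree as an eigenvalue of a regular graph *)

Section RegularSpectrum.
Variables (R : realType) (n : nat) (e : rel 'I_n.+1) (k : nat).
Hypotheses (sym_e : symmetric e) (reg_e : forall u, #|[pred v | e u v]| = k).
Local Notation A := (adjmx R e).

Lemma adjmx_row_sum u : \sum_v A u v = k%:R.
Proof.
rewrite -(reg_e u) -sum1_card natr_sum [RHS]big_mkcond /=.
by apply: eq_bigr => v _; rewrite mxE inE; case: (e u v).
Qed.

Lemma adjmx_col_sum v : \sum_u A u v = k%:R.
Proof.
by rewrite -(adjmx_row_sum v); apply: eq_bigr => u _; rewrite !mxE sym_e.
Qed.

Lemma const_mul_adjmx : (const_mx 1 : 'rV[R]_n.+1) *m A = k%:R *: const_mx 1.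
Proof.
apply/rowP => v; rewrite !mxE mulr1 -(adjmx_col_sum v).
by apply: eq_bigr => u _; rewrite mxE mul1r.
Qed.

Lemma const_mul_horner_adjmx (p : {poly R}) :
  (const_mx 1 : 'rV[R]_n.+1) *m horner_mx A p = p.[k%:R] *: const_mx 1.
Proof.
elim/poly_ind: p => [|p c IHp]; first by rewrite rmorph0 mulmx0 horner0 scale0r.
rewrite rmorphD rmorphM /= horner_mx_X horner_mx_C -mulmxE mulmxDr mulmxA IHp.
by rewrite -scalemxAl const_mul_adjmx mul_mx_scalar scalerA !hornerE scalerDl.
Qed.

Lemma regular_degree_eigenvalue : eigenvalue A k%:R.
Proof.
apply/eigenvalueP; exists (const_mx 1); first exact: const_mul_adjmx.
by apply/eqP => /rowP/(_ ord0)/eqP; rewrite !mxE oner_eq0.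
Qed.

(** At a vertex [w] where an eigenvector is largest in absolute value, [a * v 0 w] is a sum of [k]
    entries, none larger in absolute value than [v 0 w]. *)
Lemma adjmx_eigenvalue_le a : eigenvalue A a -> a <= k%:R.
Proof.
move=> /eigenvalueP[v vA v_neq0]; apply: le_trans (ler_norm a) _.
have [w _ vw_max] := @arg_maxP _ _ _ ord0 xpredT (fun u => `|v 0 u|) isT.
have vw_gt0 : 0 < `|v 0 w|.
  rewrite normr_gt0; apply: contra v_neq0 => /eqP vw0; apply/eqP/rowP => u.
  apply/eqP; rewrite mxE -normr_le0 -(normr0 R) -vw0; exact: vw_max.
rewrite -(ler_pM2r vw_gt0) -normrM.
have -> : a * v 0 w = \sum_u v 0 u * A u w.
  by have /rowP/(_ w) := vA; rewrite !mxE.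
apply: le_trans (ler_norm_sum _ _ _) _.
rewrite -(adjmx_col_sum w) mulr_suml; apply: ler_sum => u _.
have A_ge0 : 0 <= A u w by rewrite mxE ler0n.
by rewrite normrM (ger0_norm A_ge0) mulrC ler_wpM2l //; exact: vw_max.
Qed.

(* At a vertex where v is maximal, [k * v w] is the sum of the k neighbouring
   entries, so these are maximal too; maximality then spreads by
   connectedness. *)
Lemma regular_degree_eigenvector (v : 'rV[R]_n.+1) :
  connected_graph e -> v *m A = k%:R *: v -> exists c, v = const_mx c.
Proof.
move=> conn_e vA.
have [w _ vw_max] := @arg_maxP _ _ _ ord0 xpredT (v 0) isT.
exists (v 0 w).
have spread x y : e x y -> v 0 x = v 0 w -> v 0 y = v 0 w.
  move=> exy vx.
  have sum0 : \sum_u (v 0 w - v 0 u) * A u x = 0.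
    have /rowP/(_ x) := vA; rewrite !mxE vx => sumE.
    under eq_bigr do rewrite mulrBl.
    by rewrite sumrB -mulr_sumr adjmx_col_sum sumE mulrC subrr.
  have term_ge0 u : true -> 0 <= (v 0 w - v 0 u) * A u x.
    by rewrite mulr_ge0 ?mxE ?ler0n // subr_ge0; exact: vw_max.
  have := psumr_eq0P term_ge0 sum0 (isT : xpredT y).
  by rewrite mxE sym_e exy mulr1 => /eqP; rewrite subr_eq0 => /eqP.
apply/rowP => u; rewrite mxE; have /connectP[p ep ->] := conn_e w u.
elim/last_ind: p ep => [//|p x IHp]; rewrite rcons_path last_rcons.
by move=> /andP[ep ex]; apply: spread ex (IHp ep).
Qed.

Lemma mxdot_ones_horner (p : {poly R}) :
  mxdot (const_mx 1) (horner_mx A p) = p.[k%:R].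
Proof.
rewrite /mxdot (_ : _ *m _ = p.[k%:R] *: const_mx 1).
  rewrite mxtraceZ mulrCA (_ : \tr _ = n.+1%:R) ?mulVf ?mulr1 ?pnatr_eq0 //.
  rewrite /mxtrace; under eq_bigr do rewrite mxE.
  by rewrite sumr_const card_ord.
apply/row_matrixP => u; rewrite row_mul linearZ /= !row_const.
exact: const_mul_horner_adjmx.
Qed.

End RegularSpectrum.

(** * Hoffman's theorem and expansion in a graded family *)

Lemma horner_mx_neq0 (F : fieldType) (n : nat) (A : 'M[F]_n.+1) (q : {poly F}) :
  q != 0 -> (size q < size (mxminpoly A))%N -> horner_mx A q != 0.
Proof.
move=> q_neq0; rewrite ltnNge; apply: contra.
by rewrite -dvd_mxminpoly => /dvdp_leq->.
Qed.

Lemma hoffman_polynomial (R : realType) (n : nat) (e : rel 'I_n.+1) :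
  symmetric e -> connected_graph e -> regular_graph e ->
  exists2 H : {poly R}, (size H < size (mxminpoly (adjmx R e)))%N
    & horner_mx (adjmx R e) H = const_mx 1.
Proof.
move=> sym_e conn_e [k reg_e]; set A := adjmx R e.
have root_k : root (mxminpoly A) k%:R.
  by rewrite root_mxminpoly -eigenvalue_root_char regular_degree_eigenvalue.
(* The cofactor [N] of ['X - k] in the minimal polynomial is the Hoffman polynomial up to scaling:
   the rows of [N(A)] are eigenvectors for [k], hence constant. *)
have [N minE] := factor_theorem _ _ root_k.
have N_neq0 : N != 0.
  apply/eqP => N0; have := monic_neq0 (mxminpoly_monic A).
  by rewrite minE N0 mul0r eqxx.
have lt_N : (size N < size (mxminpoly A))%N.
  by rewrite minE size_Mmonic ?monicXsubC // size_XsubC addn2.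
have NA : horner_mx A N *m A = k%:R *: horner_mx A N.
  have := mx_root_minpoly A; rewrite minE rmorphM rmorphB /= horner_mx_X.
  rewrite horner_mx_C -mulmxE mulmxBr mul_mx_scalar => /eqP.
  by rewrite subr_eq0 => /eqP.
have row_cst u v : horner_mx A N u v = horner_mx A N u u.
  have := @regular_degree_eigenvector R n e k sym_e reg_e (row u (horner_mx A N)).
  rewrite -row_mul NA linearZ => /(_ conn_e erefl)[c /rowP rowE].
  by have := rowE v; have := rowE u; rewrite !mxE => -> ->.
pose c := horner_mx A N ord0 ord0.
(* Constant rows and symmetry together make all entries equal. *)
have NE : horner_mx A N = c *: const_mx 1.
  apply/matrixP => u v; rewrite !mxE mulr1 row_cst -(row_cst u ord0).
  by rewrite -{1}(horner_mx_tr N (adjmx_tr R sym_e)) mxE row_cst.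
have c_neq0 : c != 0.
  apply: contraNneq (horner_mx_neq0 N_neq0 lt_N) => c0.
  by rewrite NE c0 scale0r.
exists (c^-1 *: N); first by rewrite size_scale ?invr_eq0.
by rewrite linearZ /= NE scalerA mulVf // scale1r.
Qed.

Lemma poly_graded_expansion (F : fieldType) (p : nat -> {poly F}) (m : nat)
  (q : {poly F}) : (forall i, (i < m)%N -> size (p i) = i.+1) ->
  (size q <= m)%N -> exists c : nat -> F, q = \sum_(i < m) c i *: p i.
Proof.
elim: m q => [|m IHm] q size_p.
  by rewrite size_poly_leq0 => /eqP->; exists (fun=> 0); rewrite big_ord0.
(* Subtracting [a *: p m] cancels the coefficient of degree [m]. *)
move=> le_q; pose a := q`_m / lead_coef (p m).
have pm_neq0 : p m != 0 by rewrite -size_poly_eq0 size_p.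
have [|c qE] := IHm (q - a *: p m) (fun i lt_i => size_p i (ltnW lt_i)).
  apply/leq_sizeP => j; rewrite leq_eqVlt => /predU1P[<-|lt_mj].
    have lead_pm : (p m)`_m = lead_coef (p m) by rewrite lead_coefE size_p.
    by rewrite coefB coefZ lead_pm divfK ?subrr // lead_coef_eq0.
  by rewrite coefB coefZ !nth_default ?size_p ?mulr0 ?subrr // (leq_trans le_q).
exists (fun i => if i == m then a else c i).
rewrite big_ord_recr /= eqxx -[LHS](subrK (a *: p m)) qE; congr (_ + _).
by apply: eq_bigr => i _; rewrite (ltn_eqF (ltn_ord i)).
Qed.

(** * Distance matrices under the trace form *)

Section Distmx.
Variables (R : realType) (n : nat) (e : rel 'I_n.+1).
Local Notation A := (adjmx R e).

Lemma avg_degree_ones (h : nat) : (distmx R e h)^T = distmx R e h ->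
  avg_degree R e h = mxdot (const_mx 1) (distmx R e h).
Proof.
move=> symD; rewrite mxdotE //; congr (_ * _).
by do 2![apply: eq_bigr => ? _]; rewrite [in RHS]mxE mul1r.
Qed.

Lemma avg_degree_norm (h : nat) : (distmx R e h)^T = distmx R e h ->
  avg_degree R e h = mxdot (distmx R e h) (distmx R e h).
Proof.
move=> symD; rewrite mxdotE //; congr (_ * _).
do 2![apply: eq_bigr => ? _]; rewrite mxE.
by case: (_ == h); rewrite ?mulr1 ?mulr0.
Qed.

Lemma distmx_tr (h : nat) : symmetric e -> connected_graph e ->
  (distmx R e h)^T = distmx R e h.
Proof.
move=> sym_e conn_e.
have symA k : (A ^+ k)^T = A ^+ k.
  by have := horner_mx_tr 'X^k (adjmx_tr R sym_e); rewrite rmorphXn /= horner_mx_X.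
(* Walks are reversed through the symmetry of the powers of [A]. *)
have dist_le u v : (dist e u v <= dist e v u)%N.
  apply: walk_dist_le; rewrite -(adjmx_exp_neq0 R) -symA mxE adjmx_exp_neq0.
  exact: walk_dist.
apply/matrixP => u v; rewrite !mxE; congr (_ == h)%:R.
by apply/eqP; rewrite eqn_leq !dist_le.
Qed.

(** The two matrices have disjoint supports: [q(A)] vanishes at pairs at distance [h]. *)
Lemma mxdot_horner_distmx_lt (h : nat) (q : {poly R}) :
  (distmx R e h)^T = distmx R e h -> (size q <= h)%N ->
  mxdot (horner_mx A q) (distmx R e h) = 0.
Proof.
move=> symD le_q; rewrite mxdotE // big1 ?mulr0 // => u _; rewrite big1 // => v _.
rewrite [X in _ * X]mxE; have [dh|_] := eqVneq; last by rewrite mulr0.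
by rewrite horner_adjmx_far ?mul0r // dh.
Qed.

End Distmx.

Theorem proposition4p3 (R : realType) (n : nat) (e : rel 'I_n.+1)
  (e_simple : simple_graph e) (e_conn : connected_graph e)
  (e_reg : regular_graph e)
  (d : nat) (lam : 'I_d.+1 -> R)
  (lamP : distinct_eigenvalues (adjmx R e) lam)
  (p : nat -> {poly R})
  (pP : predistance_polys (adjmx R e) lam p)
  (h : nat) (hD : (h <= diameter e)%N)
  (orth : forall i : nat, (h < i <= d)%N ->
     mxdot (horner_mx (adjmx R e) (p i)) (distmx R e h) = 0) :
  avg_degree R e h <= (p h).[lam ord0] /\
  (avg_degree R e h = (p h).[lam ord0] <->
   punctually_distance_regular R e d h).
Proof.
have [sym_e _] := e_simple; have [k reg_e] := e_reg.
have [lam_decr lam_eig] := lamP; have [size_p orth_p norm_p] := pP.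
set A := adjmx R e in lamP pP orth lam_eig orth_p norm_p *.
set Ah := distmx R e h in orth *.
have symA : A^T = A := adjmx_tr R sym_e.
have symAh : Ah^T = Ah := distmx_tr R h sym_e e_conn.
have size_min : size (mxminpoly A) = d.+2.
  rewrite (@symmetric_mxminpoly _ _ _ (codom lam)) //.
  - by rewrite size_prod_XsubC size_codom card_ord.
  - apply/injectiveP => i j lam_ij; apply/val_inj.
    by case: (ltngtP i j) => // /lam_decr; rewrite lam_ij ltxx.
  - move=> a; apply/idP/codomP => [/lam_eig[i <-]|[i ->]]; first by exists i.
    by apply/lam_eig; exists i.
have lam0 : lam ord0 = k%:R.
  apply/le_anti; rewrite (@adjmx_eigenvalue_le R n e) //=; last first.
    by apply/lam_eig; exists ord0.
  have /lam_eig[i <-] := @regular_degree_eigenvalue R n e k sym_e reg_e.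
  have [->//|i_neq0] := eqVneq i ord0.
  by rewrite ltW // lam_decr // lt0n.
(* The diameter is below the degree [d.+1] of the minimal polynomial; hence the conditions on the
   predistance polynomials cover [p h]. *)
have le_hd : (h <= d)%N.
  rewrite -ltnS (leq_ltn_trans hD) //.
  by have := diameter_lt_mxminpoly R e_conn; rewrite size_min.
have horner_neq0 (q : {poly R}) : q != 0 -> (size q <= d.+1)%N -> horner_mx A q != 0.
  by move=> q0 le_q; rewrite horner_mx_neq0 // size_min.
have ph_neq0 : p h != 0 by rewrite -size_poly_eq0 size_p.
have norm_neq0 : (p h).[lam ord0] != 0.
  rewrite -norm_p //; apply: contraNneq (horner_neq0 _ ph_neq0 _) => [ph0|].
    by apply/eqP/mxdot_eq0 => //; apply: horner_mx_tr.
  by rewrite size_p.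
have dot_Ah i : (i <= d)%N -> i != h -> mxdot (horner_mx A (p i)) Ah = 0.
  move=> le_id; case: (ltngtP i h) => // [lt_ih|lt_hi] _.
    by apply: mxdot_horner_distmx_lt; rewrite ?size_p.
  by rewrite orth // lt_hi.
(* Here [c] is the coefficient of [p h] in [q]. Sharing it between the two pairings lets one of them
   determine [c] for the other. *)
have expand m (q : {poly R}) : (h < m <= d.+1)%N -> (size q <= m)%N -> exists c,
    mxdot (horner_mx A q) Ah = c * mxdot (horner_mx A (p h)) Ah /\
    mxdot (horner_mx A q) (horner_mx A (p h)) = c * (p h).[lam ord0].
  move=> /andP[lt_hm le_md] le_qm.
  have size_pm i : (i < m)%N -> size (p i) = i.+1.
    by move=> lt_i; rewrite size_p // -ltnS (leq_trans lt_i).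
  have [c ->] := poly_graded_expansion size_pm le_qm.
  exists (c h); rewrite rmorph_sum /=.
  have le_d (i : 'I_m) : (i <= d)%N by rewrite -ltnS (leq_trans (ltn_ord i)).
  split; rewrite mxdot_suml (bigD1 (Ordinal lt_hm)) //= linearZ /= mxdotZl.
    rewrite big1 ?addr0 // => i i_neq.
    by rewrite linearZ /= mxdotZl dot_Ah ?mulr0.
  rewrite -norm_p // big1 ?addr0 // => i i_neq.
  by rewrite linearZ /= mxdotZl [mxdot _ _]orth_p ?mulr0.
have dot_ph : mxdot (horner_mx A (p h)) Ah = avg_degree R e h.
  have [H ltH HA] := hoffman_polynomial R sym_e e_conn e_reg.
  rewrite avg_degree_ones // -HA.
  (* Pairing the all-ones matrix with [p_h(A)] evaluates [p h] at [k], which is [lam ord0]; this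
     forces [c = 1]. *)
  have [||c [-> cE]] := expand d.+1 H; rewrite ?ltnS ?le_hd ?leqnn //.
    by rewrite -ltnS -size_min.
  move: cE; rewrite HA (mxdot_ones_horner sym_e reg_e) -lam0.
  by rewrite -[LHS]mul1r => /(mulIf norm_neq0) <-; rewrite mul1r.
pose E := Ah - horner_mx A (p h).
have symE : E^T = E by rewrite linearB /= symAh horner_mx_tr.
have normE : mxdot E E = (p h).[lam ord0] - avg_degree R e h.
  rewrite /E -[- horner_mx _ _]scaleN1r mxdotDl mxdotZl.
  rewrite ![mxdot _ (_ + _)]mxdotC !mxdotDl !mxdotZl.
  rewrite -(avg_degree_norm symAh) (mxdotC Ah) dot_ph [mxdot _ _]norm_p //.
  by ring.
split; first by rewrite -subr_ge0 -normE mxdot_ge0.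
split=> [eq_h|[q [le_q size_q AhE]]].
  exists (p h); split; rewrite ?size_p //.
  apply/eqP; rewrite -subr_eq0 -/E; apply/eqP/mxdot_eq0 => //.
  by rewrite normE eq_h subrr.
have q_neq0 : q != 0 by rewrite -size_poly_eq0 size_q.
(* This is the squared norm of [q(A)], and [q] is nonzero of degree below that of the minimal
   polynomial. *)
have delta_neq0 : avg_degree R e h != 0.
  rewrite avg_degree_norm //; apply: contraNneq (horner_neq0 q q_neq0 le_q).
  by move=> /(mxdot_eq0 symAh); rewrite -AhE => /eqP.
have [||c [cAh cph]] := expand h.+1 q; rewrite ?ltnS ?leqnn ?size_q //.
(* The first equation now says that the average degree is [c] times itself, so [c = 1], and the
   second becomes the goal. *)
move: cAh cph; rewrite -AhE -avg_degree_norm // (mxdotC Ah) dot_ph.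
by rewrite -{1}[avg_degree R e h]mul1r => /(mulIf delta_neq0) <-; rewrite mul1r.
Qed.
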